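(* Let $f\colon[0,1]\to\mathbb{R}$ be a continuous non-decreasing interval-r.e.\ function. Then there is a computable function $g\colon[0,1]\to\mathbb{R}$ such that $f(x)=V(g,[0,x])$ for every $x\in[0,1]$.
   Context: A real $x$ is left-r.e.\ if $\{q\in\mathbb{Q}: q<x\}$ is recursively enumerable. A non-decreasing function $f$ on $[0,1]$ is interval-r.e.\ if $f(0)=0$ and $f(y)-f(x)$ is a left-r.e.\ real uniformly in rationals $0\le x<y\le 1$. A function $g\colon[0,1]\to\mathbb{R}$ is computable if $g(q)$ is a computable real uniformly in rationals $q\in[0,1]$ and $g$ is effectively uniformly continuous (there is a computable $h\colon\mathbb{N}\to\mathbb{N}$ with $|x-y|<2^{-h(n)}\Rightarrow |g(x)-g(y)|<2^{-n}$). The variation is $V(g,[x,y])=\sup\{\sum_{i=1}^{n-1}|g(t_{i+1})-g(t_i)| : x\le t_1\le\dots\le t_n\le y\}$. *)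

(* Defs.v *)
From HB Require Import structures.
From mathcomp Require Import all_boot all_order all_algebra.
From mathcomp Require Import all_classical all_reals all_analysis.
Import Order.TTheory GRing.Theory Num.Theory.
Import numFieldNormedType.Exports.

Set Implicit Arguments.
Unset Strict Implicit.
Unset Printing Implicit Defensive.

Local Open Scope classical_set_scope.
Local Open Scope ring_scope.

(* Total recursive functions N^k -> N.  Minimisation is restricted to regular
   functions, so every member of the class is total.  Primitive recursion and
   minimisation are given by their defining equations on h. *)
Inductive recursive : forall k : nat, (k.-tuple nat -> nat) -> Prop :=
| recursive_zero : @recursive 0 (fun=> 0%N)
| recursive_succ : @recursive 1 (fun v => (thead v).+1)
| recursive_proj (k : nat) (i : 'I_k) : recursive (fun v => tnth v i)
| recursive_comp (m k : nat) (f : m.-tuple nat -> nat)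
    (g : 'I_m -> k.-tuple nat -> nat) :
    recursive f -> (forall i, recursive (g i)) ->
    recursive (fun v => f [tuple g i v | i < m])
| recursive_prim (k : nat) (f : k.-tuple nat -> nat)
    (g : k.+2.-tuple nat -> nat) (h : k.+1.-tuple nat -> nat) :
    recursive f -> recursive g ->
    (forall v : k.-tuple nat, h [tuple of 0%N :: v] = f v) ->
    (forall n (v : k.-tuple nat), h [tuple of n.+1 :: v]
                 = g [tuple of n :: h [tuple of n :: v] :: v]) ->
    recursive h
| recursive_min (k : nat) (f : k.+1.-tuple nat -> nat) (h : k.-tuple nat -> nat) :
    recursive f ->
    (forall v : k.-tuple nat, f [tuple of h v :: v] = 0%N) ->
    (forall (v : k.-tuple nat) n, (n < h v)%N -> f [tuple of n :: v] <> 0%N) ->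
    recursive h.

Definition recursively_enumerable (k : nat) (S : set (k.-tuple nat)) : Prop :=
  S = set0 \/
  exists F : 'I_k -> 1.-tuple nat -> nat,
    (forall i, recursive (F i)) /\
    S = range (fun n : nat => [tuple F i [tuple n] | i < k]).

(* The natural number 2^a * 3^b * 5^c codes the rational (a - b) / (c + 1).
   Every natural number is a code, and every rational has infinitely many. *)
Definition rat_of_code (e : nat) : rat :=
  ((logn 2 e)%:R - (logn 3 e)%:R) / (logn 5 e).+1%:R.

Lemma rat_of_code_onto (q : rat) : exists e : nat, rat_of_code e = q.
Proof.
suff codeE a b c : rat_of_code (2 ^ a * 3 ^ b * 5 ^ c)
                   = (a%:R - b%:R) / c.+1%:R.
  have d_gt0 : (0 < `|denq q|)%N by rewrite absz_gt0 denq_neq0.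
  have dE : (`|denq q|.-1.+1)%:R = (denq q)%:~R :> rat.
    by rewrite prednK// natr_absz gtr0_norm ?denq_gt0.
  rewrite -[q]divq_num_den; case: (numq q) => m.
  - by exists (2 ^ m * 3 ^ 0 * 5 ^ `|denq q|.-1)%N; rewrite codeE dE subr0.
  - exists (2 ^ 0 * 3 ^ m.+1 * 5 ^ `|denq q|.-1)%N.
    by rewrite codeE dE sub0r NegzE mulrNz.
by rewrite /rat_of_code !lognM ?muln_gt0 ?expn_gt0// !lognX !logn_prime//=
  !muln0 !muln1 !addn0 !add0n.
Qed.

Definition rats_of_codes (k : nat) (v : k.-tuple nat) : k.-tuple rat :=
  map_tuple rat_of_code v.

Section computability.
Variable R : realType.
Implicit Types (f g : R -> R) (k : nat).

(* The reals r p, for p in D, are left-r.e. uniformly in p: the relation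
   "p is in D and q < r p" between rationals is r.e.  For k = 0 and D = setT
   this says that a single real is left-r.e. *)
Definition uniformly_left_re k (D : set (k.-tuple rat)) (r : k.-tuple rat -> R)
    : Prop :=
  recursively_enumerable
    [set w : k.+1.-tuple nat |
      let q := rat_of_code (thead w) in
      let p := rats_of_codes [tuple of behead w] in
      D p /\ ratr q < r p].

(* The reals r p, for p in D, are computable uniformly in p: a recursive
   function maps n and a code of p to a code of a rational within 2^-n of r p.
   For k = 0 and D = setT this says that a single real is computable. *)
Definition uniformly_computable k (D : set (k.-tuple rat))
    (r : k.-tuple rat -> R) : Prop :=
  exists2 F : k.+1.-tuple nat -> nat, recursive F &
    forall (n : nat) (v : k.-tuple nat), D (rats_of_codes v) ->
      `|r (rats_of_codes v) - ratr (rat_of_code (F [tuple of n :: v]))|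
        <= 2 ^- n.

(* Functions on [0, 1] are represented by functions on R whose values outside
   [0, 1] are never used. *)

Definition interval_re f : Prop :=
  f 0 = 0 /\
  uniformly_left_re
    [set p : 2.-tuple rat |
      0 <= tnth p ord0 /\ tnth p ord0 < tnth p ord_max /\ tnth p ord_max <= 1]
    (fun p => f (ratr (tnth p ord_max)) - f (ratr (tnth p ord0))).

Definition effectively_uniformly_continuous g : Prop :=
  exists2 h : 1.-tuple nat -> nat, recursive h &
    forall (n : nat) (x y : R), x \in `[0, 1] -> y \in `[0, 1] ->
      `|x - y| < 2 ^- (h [tuple n]) -> `|g x - g y| < 2 ^- n.

Definition computable_function g : Prop :=
  uniformly_computable
    [set p : 1.-tuple rat | 0 <= thead p /\ thead p <= 1]
    (fun p => g (ratr (thead p))) /\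
  effectively_uniformly_continuous g.

End computability.

(* Main.v *)
(* The function g is a limit of step functions G_s.  G_s takes the value
   u_i / 4^m on the i-th dyadic interval of level m = m_s, where u is a sequence
   of natural numbers, each step of which has |u_(i+1) - u_i| / 4^m either zero
   or verifiably smaller than the increment of f over that interval; so no
   limit of the G_s can vary more than f.  The next path u' lives on a finer
   grid, takes steps as large as f allows, and on each old interval moves
   towards the old value at its right endpoint, and then oscillates around it.
   Hence G_(s+1) is uniformly close to G_s, and so much closer on the old grid
   that the variation of G_s over that grid is not lost in the limit, while the
   variation of G_s over its grid exhausts f 1.  Existence of u' uses uniform
   continuity of f; finding it is an unbounded search for a path and
   enumeration indices that satisfy decidable conditions.  All paths start at a
   large constant C, which keeps them nonnegative. *)
Require Import Defs.
From mathcomp Require Import all_boot all_order all_algebra.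
From mathcomp Require Import all_classical all_reals all_analysis.
From mathcomp Require Import zify lra.
Import Order.TTheory GRing.Theory Num.Theory.
Import numFieldNormedType.Exports.

Set Implicit Arguments.
Unset Strict Implicit.
Unset Printing Implicit Defensive.

Local Open Scope nat_scope.

(** * Closure properties of the recursive functions *)

Lemma recursive_ext k (f g : k.-tuple nat -> nat) :
  recursive f -> f =1 g -> recursive g.
Proof. by move=> rf fg; rewrite -(funext fg). Qed.

Lemma behead_consE (T : Type) k (x : T) (v : k.-tuple T) :
  [tuple of behead [tuple of x :: v]] = v.
Proof. exact: val_inj. Qed.

Lemma recursive_nth k i : recursive (fun v : k.-tuple nat => nth 0 v i).
Proof.
have [ik|ki] := ltnP i k.
  apply: recursive_ext (recursive_proj (Ordinal ik)) _ => v.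
  by rewrite (tnth_nth 0).
apply: recursive_ext
  (recursive_comp (k := k) (g := fun=> fun=> 0) recursive_zero _) _.
  by case.
by move=> v; rewrite nth_default// size_tuple.
Qed.

(** Reading components with [nth] lets the index range over all naturals, so consing and beheading
    only shift it. *)
Definition recursive_map k j (p : k.-tuple nat -> j.-tuple nat) :=
  forall i, recursive (fun v => nth 0 (p v) i).

Lemma recursive_map_id k : recursive_map (fun v : k.-tuple nat => v).
Proof. exact: recursive_nth. Qed.

Lemma recursive_map_behead k j (p : k.-tuple nat -> j.+1.-tuple nat) :
  recursive_map p -> recursive_map (fun v => [tuple of behead (p v)]).
Proof.
by move=> rp i; apply: recursive_ext (rp i.+1) _ => v; rewrite /= nth_behead.
Qed.

Lemma recursive_map_cons k j (f : k.-tuple nat -> nat)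
    (p : k.-tuple nat -> j.-tuple nat) :
  recursive f -> recursive_map p ->
  recursive_map (fun v => [tuple of f v :: p v]).
Proof. by move=> rf rp [|i] //=; exact: rp. Qed.

Lemma recursive_map_nil k :
  recursive_map (fun _ : k.-tuple nat => [tuple] : 0.-tuple nat).
Proof.
by move=> i; apply: recursive_ext (recursive_nth k k) _ => v;
  rewrite nth_nil nth_default// size_tuple.
Qed.

Lemma recursive_thead k j (p : k.-tuple nat -> j.+1.-tuple nat) :
  recursive_map p -> recursive (fun v => thead (p v)).
Proof.
by move=> rp; apply: recursive_ext (rp 0) _ => v; rewrite [thead _](tnth_nth 0).
Qed.

Lemma recursive_subst k j (f : j.-tuple nat -> nat)
    (p : k.-tuple nat -> j.-tuple nat) :
  recursive f -> recursive_map p -> recursive (fun v => f (p v)).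
Proof.
move=> rf rp.
apply: recursive_ext (recursive_comp (g := fun i v => nth 0 (p v) i) rf _) _.
  by move=> i; exact: rp.
by move=> v; congr f; apply: eq_from_tnth => i;
  rewrite tnth_mktuple (tnth_nth 0).
Qed.

Lemma recursive_S k (f : k.-tuple nat -> nat) :
  recursive f -> recursive (fun v => (f v).+1).
Proof.
move=> rf; apply: recursive_ext (recursive_subst recursive_succ
  (recursive_map_cons rf (recursive_map_nil k))) _ => v.
by rewrite theadE.
Qed.

Lemma recursive_const k c : recursive (fun _ : k.-tuple nat => c).
Proof.
elim: c => [|c]; last exact: recursive_S.
by apply: recursive_ext (recursive_nth k k) _ => v;
  rewrite nth_default// size_tuple.
Qed.

Lemma recursive_nat_rec k (f b : k.-tuple nat -> nat)
    (g : nat -> nat -> k.-tuple nat -> nat) :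
  recursive f ->
  recursive (fun w : k.+2.-tuple nat =>
    g (thead w) (thead [tuple of behead w])
      [tuple of behead [tuple of behead w]]) ->
  recursive b ->
  recursive (fun v => nat_rec _ (f v) (fun n r => g n r v) (b v)).
Proof.
move=> rf rg rb.
pose h (w : k.+1.-tuple nat) :=
  let v := [tuple of behead w] in
  nat_rec (fun=> nat) (f v) (fun n r => g n r v) (thead w).
have rh : recursive h.
  apply: (recursive_prim rf rg) => [v|n v]; rewrite /h; cbv beta zeta.
    by rewrite theadE behead_consE.
  by rewrite !(theadE, behead_consE).
apply: recursive_ext (recursive_subst rh
  (recursive_map_cons rb (@recursive_map_id k))) _ => v.
by rewrite /h ?theadE ?behead_consE.
Qed.

Ltac rec_env := repeat first
  [ exact: recursive_map_id | apply: recursive_map_behead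
  | apply: recursive_map_cons | exact: recursive_map_nil ].

Lemma recursive_min_bool k (P : nat -> k.-tuple nat -> bool)
    (h : k.-tuple nat -> nat) :
  recursive (fun w : k.+1.-tuple nat =>
     nat_of_bool (~~ P (thead w) [tuple of behead w])) ->
  (forall v, P (h v) v) -> (forall v n, n < h v -> ~~ P n v) -> recursive h.
Proof.
move=> rP Ph minh.
apply: (recursive_min rP) => [v|v n nh]; rewrite theadE behead_consE.
  by rewrite Ph.
by rewrite minh.
Qed.

Lemma recursive_add k (f g : k.-tuple nat -> nat) :
  recursive f -> recursive g -> recursive (fun v => f v + g v).
Proof.
move=> rf rg; have := @recursive_nat_rec k f g (fun n r v => r.+1) rf.
move=> /(_ _ rg) H; apply: recursive_ext (H _) _.
  by apply/recursive_S/recursive_thead; rec_env.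
by move=> v; elim: (g v) => [|n IH] /=; rewrite ?addn0// addnS IH.
Qed.

Lemma recursive_pred k (f : k.-tuple nat -> nat) :
  recursive f -> recursive (fun v => (f v).-1).
Proof.
move=> rf; have := @recursive_nat_rec k (fun=> 0) f (fun n r v => n).
move=> /(_ (recursive_const _ _) _ rf) H; apply: recursive_ext (H _) _.
  by apply/recursive_thead; rec_env.
by move=> v; case: (f v).
Qed.

Lemma recursive_sub k (f g : k.-tuple nat -> nat) :
  recursive f -> recursive g -> recursive (fun v => f v - g v).
Proof.
move=> rf rg; have := @recursive_nat_rec k f g (fun n r v => r.-1) rf.
move=> /(_ _ rg) H; apply: recursive_ext (H _) _.
  by apply/recursive_pred/recursive_thead; rec_env.
by move=> v; elim: (g v) => [|n IH] /=; rewrite ?subn0// subnS IH.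
Qed.

Lemma recursive_sum k (f : k.-tuple nat -> nat)
    (F : nat -> k.-tuple nat -> nat) :
  recursive (fun w : k.+1.-tuple nat => F (thead w) [tuple of behead w]) ->
  recursive f -> recursive (fun v => \sum_(0 <= i < f v) F i v).
Proof.
move=> rF rf.
have := @recursive_nat_rec k (fun=> 0) f (fun n r v => r + F n v).
move=> /(_ (recursive_const _ _) _ rf) H; apply: recursive_ext (H _) _.
  apply: recursive_add; first by apply/recursive_thead; rec_env.
  pose p (w : k.+2.-tuple nat) :=
    [tuple of thead w :: [tuple of behead [tuple of behead w]]].
  apply: recursive_ext (recursive_subst (p := p) rF _) _ => [|w].
    apply: recursive_map_cons; first by apply/recursive_thead; rec_env.
    by rec_env.
  by rewrite /p theadE; congr F; apply: val_inj.
by move=> v; elim: (f v) => [|n IH] /=;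
  [rewrite big_geq | rewrite big_nat_recr// IH].
Qed.

Lemma recursive_mul k (f g : k.-tuple nat -> nat) :
  recursive f -> recursive g -> recursive (fun v => f v * g v).
Proof.
move=> rf rg; apply: recursive_ext (recursive_sum (F := fun i v => f v) _ rg) _.
  by apply: (recursive_subst (f := f)); rec_env.
by move=> v; rewrite sum_nat_const_nat subn0 mulnC.
Qed.

Lemma recursive_exp k (f g : k.-tuple nat -> nat) :
  recursive f -> recursive g -> recursive (fun v => f v ^ g v).
Proof.
move=> rf rg; have := @recursive_nat_rec k (fun=> 1) g (fun n r v => r * f v).
move=> /(_ (recursive_const _ _) _ rg) H; apply: recursive_ext (H _) _.
  apply: recursive_mul; first by apply/recursive_thead; rec_env.
  by apply: (recursive_subst (f := f)); rec_env.
by move=> v; elim: (g v) => [|n IH] //=; rewrite expnSr IH.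
Qed.

Lemma recursive_neg k (P : k.-tuple nat -> bool) :
  recursive (fun v => nat_of_bool (P v)) ->
  recursive (fun v => nat_of_bool (~~ P v)).
Proof.
move=> rP; apply: recursive_ext (recursive_sub (recursive_const k 1) rP) _.
by move=> v; case: (P v).
Qed.

Lemma recursive_and k (P Q : k.-tuple nat -> bool) :
  recursive (fun v => nat_of_bool (P v)) ->
  recursive (fun v => nat_of_bool (Q v)) ->
  recursive (fun v => nat_of_bool (P v && Q v)).
Proof.
move=> rP rQ; apply: recursive_ext (recursive_mul rP rQ) _.
by move=> v; rewrite mulnb.
Qed.

Lemma recursive_eq0 k (f : k.-tuple nat -> nat) :
  recursive f -> recursive (fun v => nat_of_bool (f v == 0)).
Proof.
move=> rf; apply: recursive_ext (recursive_sub (recursive_const k 1) rf) _.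
by move=> v; case: (f v).
Qed.

Lemma recursive_or k (P Q : k.-tuple nat -> bool) :
  recursive (fun v => nat_of_bool (P v)) ->
  recursive (fun v => nat_of_bool (Q v)) ->
  recursive (fun v => nat_of_bool (P v || Q v)).
Proof.
move=> rP rQ.
apply: recursive_ext
  (recursive_neg (recursive_and (recursive_neg rP) (recursive_neg rQ))) _.
by move=> v; rewrite negb_and !negbK.
Qed.

Lemma recursive_implies k (P Q : k.-tuple nat -> bool) :
  recursive (fun v => nat_of_bool (P v)) ->
  recursive (fun v => nat_of_bool (Q v)) ->
  recursive (fun v => nat_of_bool (P v ==> Q v)).
Proof.
move=> rP rQ; apply: recursive_ext (recursive_or (recursive_neg rP) rQ) _.
by move=> v; rewrite implybE.
Qed.

Lemma recursive_leq k (f g : k.-tuple nat -> nat) :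
  recursive f -> recursive g ->
  recursive (fun v => nat_of_bool (f v <= g v)).
Proof. by move=> rf rg; apply/recursive_eq0/recursive_sub. Qed.

Lemma recursive_forall k (f : k.-tuple nat -> nat)
    (P : nat -> k.-tuple nat -> bool) :
  recursive (fun w : k.+1.-tuple nat =>
     nat_of_bool (P (thead w) [tuple of behead w])) ->
  recursive f -> recursive (fun v => nat_of_bool (all (P^~ v) (iota 0 (f v)))).
Proof.
move=> rP rf; apply: recursive_ext (recursive_eq0 (recursive_sum
  (F := fun i v => nat_of_bool (~~ P i v)) (recursive_neg rP) rf)) _ => v.
rewrite sum_nat_seq_eq0 /index_iota subn0; congr nat_of_bool.
by apply: eq_all => i; case: (P i v).
Qed.

Lemma recursive_exists k (f : k.-tuple nat -> nat)
    (P : nat -> k.-tuple nat -> bool) :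
  recursive (fun w : k.+1.-tuple nat =>
     nat_of_bool (P (thead w) [tuple of behead w])) ->
  recursive f -> recursive (fun v => nat_of_bool (has (P^~ v) (iota 0 (f v)))).
Proof.
move=> rP rf; apply: recursive_ext (recursive_neg (recursive_forall
  (P := fun i v => ~~ P i v) (recursive_neg rP) rf)) _ => v.
by rewrite -has_predC; congr nat_of_bool; apply: eq_has => i; rewrite /= negbK.
Qed.

Lemma recursive_eq k (f g : k.-tuple nat -> nat) :
  recursive f -> recursive g ->
  recursive (fun v => nat_of_bool (f v == g v)).
Proof.
move=> rf rg; apply: recursive_ext
  (recursive_and (recursive_leq rf rg) (recursive_leq rg rf)) _ => v.
by rewrite eqn_leq.
Qed.

Lemma recursive_divn k (f g : k.-tuple nat -> nat) :
  recursive f -> recursive g -> recursive (fun v => f v %/ g v).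
Proof.
move=> rf rg.
(* The disjunct [g v == 0] ends the search at 0, the value of [%/] for divisor 0. *)
apply: (@recursive_min_bool _ (fun q v => (g v == 0) || (f v < q.+1 * g v))).
- apply/recursive_neg/recursive_or; [apply: recursive_eq0|apply: recursive_leq].
  + by apply: (recursive_subst (f := g)); rec_env.
  + by apply/recursive_S; apply: (recursive_subst (f := f)); rec_env.
  + apply: recursive_mul; first by apply/recursive_S/recursive_thead; rec_env.
    by apply: (recursive_subst (f := g)); rec_env.
- by move=> v; case: eqVneq => //=; rewrite -lt0n => /ltn_ceil; exact.
- move=> v q; rewrite negb_or -leqNgt => qfg.
  have g0 : g v != 0 by apply: contraTneq qfg => ->; rewrite divn0.
  by rewrite g0 /= -leq_divRL ?lt0n.
Qed.

Lemma recursive_modn k (f g : k.-tuple nat -> nat) :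
  recursive f -> recursive g -> recursive (fun v => f v %% g v).
Proof.
move=> rf rg; apply: recursive_ext
  (recursive_sub rf (recursive_mul (recursive_divn rf rg) rg)) _ => v.
by rewrite {1}(divn_eq (f v) (g v)) addKn.
Qed.

Lemma recursive_dvdn k (f g : k.-tuple nat -> nat) :
  recursive f -> recursive g -> recursive (fun v => nat_of_bool (f v %| g v)).
Proof. by move=> rf rg; apply/recursive_eq0/recursive_modn. Qed.

Lemma recursive_logn k p (f : k.-tuple nat -> nat) :
  prime p -> recursive f -> recursive (fun v => logn p (f v)).
Proof.
move=> pp rf.
(* Every power of [p] divides 0, so the disjunct [f v == 0] is what stops the search there, at the
   value [logn p 0 = 0]. *)
apply: (@recursive_min_bool _ (fun e v => (f v == 0) || ~~ (p ^ e.+1 %| f v))).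
- have rf' : recursive (fun w : k.+1.-tuple nat => f [tuple of behead w]).
    by apply: (recursive_subst (f := f)); rec_env.
  apply/recursive_neg/recursive_or; first exact: recursive_eq0.
  apply/recursive_neg/recursive_dvdn => //; apply: recursive_exp.
    exact: recursive_const.
  by apply/recursive_S/recursive_thead; rec_env.
- by move=> v; case: posnP => //= f0; rewrite pfactor_dvdn// ltnn.
- by move=> v e; case: posnP => [->|f0]; rewrite ?logn0// pfactor_dvdn//= negbK.
Qed.

(** Closure under substitution at every arity, so that functions of one to three numbers can be used
    without building tuples. *)
Definition recursive1 (h : nat -> nat) :=
  forall k (f : k.-tuple nat -> nat), recursive f ->
    recursive (fun v => h (f v)).

Definition recursive2 (h : nat -> nat -> nat) :=
  forall k (f g : k.-tuple nat -> nat), recursive f -> recursive g ->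
    recursive (fun v => h (f v) (g v)).

Definition recursive3 (h : nat -> nat -> nat -> nat) :=
  forall k (f g d : k.-tuple nat -> nat),
    recursive f -> recursive g -> recursive d ->
    recursive (fun v => h (f v) (g v) (d v)).

Ltac recursive_step := cbv beta; lazymatch goal with
  | H : recursive ?f |- recursive ?f => exact: H
  | |- recursive (fun _ => ?c) => exact: recursive_const
  | |- recursive (@thead _ _) =>
      exact: (recursive_thead (@recursive_map_id _))
  | |- recursive (fun v => thead (@?p v)) => apply: recursive_thead; rec_env
  | |- recursive (fun v => (@?f v).+1) => apply: (@recursive_S _ f)
  | |- recursive (fun v => (@?f v).-1) => apply: (@recursive_pred _ f)
  | |- recursive (fun v => @?f v + @?g v) => apply: (@recursive_add _ f g)
  | |- recursive (fun v => @?f v - @?g v) => apply: (@recursive_sub _ f g)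
  | |- recursive (fun v => @?f v * @?g v) => apply: (@recursive_mul _ f g)
  | |- recursive (fun v => @?f v ^ @?g v) => apply: (@recursive_exp _ f g)
  | |- recursive (fun v => @?f v %/ @?g v) => apply: (@recursive_divn _ f g)
  | |- recursive (fun v => @?f v %% @?g v) => apply: (@recursive_modn _ f g)
  | |- recursive (fun v => logn ?p (@?f v)) =>
      apply: (@recursive_logn _ p f); [by []|]
  | |- recursive (fun v => nat_of_bool (@?f v <= @?g v)) =>
      apply: (@recursive_leq _ f g)
  | |- recursive (fun v => nat_of_bool (@?f v == @?g v)) =>
      apply: (@recursive_eq _ f g)
  | |- recursive (fun v => nat_of_bool (~~ @?P v)) =>
      apply: (@recursive_neg _ P)
  | |- recursive (fun v => nat_of_bool (@?P v && @?Q v)) =>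
      apply: (@recursive_and _ P Q)
  | |- recursive (fun v => nat_of_bool (@?P v || @?Q v)) =>
      apply: (@recursive_or _ P Q)
  | |- recursive (fun v => nat_of_bool (@?P v ==> @?Q v)) =>
      apply: (@recursive_implies _ P Q)
  | |- recursive (fun v => nat_of_bool (all (@?P v) (iota 0 (@?f v)))) =>
      apply: recursive_forall
  | |- recursive (fun v => nat_of_bool (has (@?P v) (iota 0 (@?f v)))) =>
      apply: recursive_exists
  | |- recursive (fun v => \sum_(0 <= i < @?f v) @?P v i) =>
      apply: recursive_sum
  | _ => match goal with
    | H : recursive1 _ |- _ => apply: H
    | H : recursive2 _ |- _ => apply: H
    | H : recursive3 _ |- _ => apply: H
    | H : recursive ?f |- recursive (fun v => ?f (@?p v)) =>
        apply: (recursive_subst H); rec_env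
    end
  end.

Ltac recursive_tac := repeat recursive_step.

(** Totality of [step] makes the search for the least successor regular, and primitive recursion
    iterates it. *)
Lemma recursive_dependent_choice (step : nat -> nat -> nat -> bool) r0 :
  recursive3 (fun s r n => step s r n) ->
  (forall s r, exists n, step s r n) ->
  exists2 st, recursive1 st & st 0 = r0 /\ forall s, step s (st s) (st s.+1).
Proof.
move=> rstep exstep.
pose next s r := ex_minn (exstep s r).
have rnext : recursive2 next.
  move=> k f g rf rg.
  apply: (@recursive_min_bool _ (fun n v => step (f v) (g v) n)).
  - by recursive_tac.
  - by move=> v; rewrite /next; case: ex_minnP.
  - move=> v n; rewrite /next; case: ex_minnP => m _ minm.
    by rewrite ltnNge; apply/contra/minm.
exists (nat_rec (fun=> nat) r0 next); last first.
  by split=> // s; rewrite /= /next; case: ex_minnP.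
move=> k f rf.
apply: (recursive_nat_rec (f := fun=> r0) (g := fun n r _ => next n r)) => //.
  exact: recursive_const.
by recursive_tac.
Qed.

(** * Dyadic paths and their codes *)

(** Truncated subtraction kills one summand, which leaves |x - y|. *)
Definition dist x y := x - y + (y - x).

(** Puts three exponents where [rat_of_code] reads them; the same packing stores the level, the
    bound and the digits of a path. *)
Definition code a b c := 2 ^ a * 3 ^ b * 5 ^ c.

Lemma code_logn a b c :
  [/\ logn 2 (code a b c) = a, logn 3 (code a b c) = b
    & logn 5 (code a b c) = c].
Proof.
by rewrite /code !lognM ?muln_gt0 ?expn_gt0// !lognX !logn_prime//=
  !muln0 !muln1 !addn0 !add0n.
Qed.

(* r codes the path u_0, u_1, ... on the dyadic grid of level [lev r], where u_i
   is the i-th digit of [logn 5 r] in base 2 ^ [bnd r]; [bnd r] also bounds the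
   indices at which the inequalities about r are enumerated. *)
Definition lev r := logn 2 r.
Definition bnd r := logn 3 r.
Definition val_at r i := (logn 5 r %/ (2 ^ bnd r) ^ i) %% 2 ^ bnd r.
Definition jump r i := dist (val_at r i.+1) (val_at r i).

Lemma exists_digits B (u : nat -> nat) N : (forall i, i < N -> u i < B) ->
  exists P, forall i, i < N -> (P %/ B ^ i) %% B = u i.
Proof.
elim: N u => [|N IH] u uB; first by exists 0.
have [i iN|P PE] := IH (fun i => u i.+1); first exact: uB.
exists (P * B + u 0) => -[_|i]; have B0 := leq_ltn_trans (leq0n _) (uB 0 isT).
  by rewrite expn0 divn1 modnMDl modn_small ?uB.
by rewrite ltnS => iN;
  rewrite expnS divnMA divnMDl// (divn_small (uB 0 isT)) addn0 PE.
Qed.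

Lemma exists_state m t0 (u : nat -> nat) N :
  exists r, [/\ lev r = m, t0 <= bnd r & forall i, i < N -> val_at r i = u i].
Proof.
(* The base [2 ^ t] exceeds every value of the path, and [t0] leaves room for enumeration
   indices. *)
pose t := t0 + \sum_(i < N) u i.
have [i iN|P PE] := @exists_digits (2 ^ t) u N.
  apply: leq_trans (ltn_expl (u i) (isT : 1 < 2)) _; rewrite leq_exp2l// /t.
  by rewrite (bigD1 (Ordinal iN))//= addnCA leq_addr.
exists (code m t P); have [h2 h3 h5] := code_logn m t P.
by rewrite /lev /bnd /val_at /bnd h2 h3 h5; split=> //; rewrite leq_addr.
Qed.

Section construction.
(* e0, e1, e2 will enumerate the codes of the triples (q, x, y) of rationals
   with 0 <= x < y <= 1 and q < f y - f x. *)
Context (C : nat) (e0 e1 e2 : nat -> nat).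

(** The predecessors offset the [.+1] in the denominator of [rat_of_code], so the triple is a / 4^m,
    i / 2^m, (i+1) / 2^m. Asking for these particular codes loses nothing, since [enumerates] covers
    all codes. *)
Definition witnessed m a i n := [&& e0 n == code a 0 (4 ^ m).-1,
  e1 n == code i 0 (2 ^ m).-1 & e2 n == code i.+1 0 (2 ^ m).-1].

(** The bound 2^-s on the steps will give the modulus of continuity; limiting the enumeration
    indices by [bnd r] keeps the condition decidable. *)
Definition valid s r := (val_at r 0 == C * 4 ^ lev r) &&
  all (fun i => (jump r i * 2 ^ s <= 4 ^ lev r) &&
    ((jump r i == 0) ||
     has (fun n => witnessed (lev r) (jump r i) i n) (iota 0 (bnd r))))
    (iota 0 (2 ^ lev r)).

(* The numbers 1 and 2 are codes of the rationals 0 and 1, so that the last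
   clause asks for variation at least q if the s-th triple is (q, 0, 1). *)
Definition refines s r n := [&& lev r < lev n,
  all (fun i => 2 ^ (s + lev r) *
     dist (val_at n (i * 2 ^ (lev n - lev r)))
          (val_at r i * 4 ^ (lev n - lev r)) <= 4 ^ lev n)
    (iota 0 (2 ^ lev r).+1),
  all (fun j => 2 ^ s *
     dist (val_at n j)
       (val_at r (j %/ 2 ^ (lev n - lev r)) * 4 ^ (lev n - lev r))
       <= 3 * 4 ^ lev n)
    (iota 0 (2 ^ lev n).+1) &
  (e1 s == 1) && (e2 s == 2) ==>
   (logn 2 (e0 s) * 4 ^ lev n <=
     (\sum_(0 <= j < 2 ^ lev n) jump n j) * (logn 5 (e0 s)).+1
       + logn 3 (e0 s) * 4 ^ lev n)].

(** The guard gives every [s] and [r] a successor, as [recursive_dependent_choice] requires; it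
    holds along any sequence with a valid start. *)
Definition step s r n := valid s r ==> (valid s.+1 n && refines s r n).

Lemma recursive_step_relation :
  recursive1 e0 -> recursive1 e1 -> recursive1 e2 ->
  recursive3 (fun s r n => step s r n).
Proof.
move=> re0 re1 re2.
have rval : recursive2 val_at.
  by move=> k f g rf rg; rewrite /val_at /bnd; recursive_tac.
have rjump : recursive2 jump.
  by move=> k f g rf rg; rewrite /jump /dist; recursive_tac.
have rvalid : recursive2 (fun s r => valid s r).
  move=> k f g rf rg; rewrite /valid /witnessed /lev /bnd /code.
  by recursive_tac.
move=> k f g d rf rg rd; rewrite /step /refines /lev /dist.
by recursive_tac.
Qed.

End construction.

(** * Zigzag refinements of a path *)

Lemma dist_triangle x y z : dist x z <= dist x y + dist y z.
Proof. rewrite /dist; lia. Qed.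

(** Step lengths are prescribed and only the direction is chosen, so the variation is fixed by [w]
    while the position can be steered. *)
Fixpoint zigzag (x0 : nat) (w T : nat -> nat) j :=
  if j is j'.+1 then
    let x := zigzag x0 w T j' in if x <= T j' then x + w j' else x - w j'
  else x0.

Section zigzag_theory.
Context (x0 : nat) (w T : nat -> nat) (N : nat).
Hypothesis sum_le : \sum_(0 <= j < N) w j <= x0.
Local Notation x := (zigzag x0 w T).

(** The walk has descended by at most its earlier steps, and all steps together fit below [x0]; so
    no subtraction in [zigzag] truncates. *)
Lemma zigzag_ge j : j < N -> w j <= x j.
Proof.
have x0_le i : x0 <= x i + \sum_(0 <= l < i) w l.
  elim: i => [|i IH]; first by rewrite big_geq// addn0.
  by rewrite big_nat_recr//=; case: ifP => _; lia.
move=> jN; have : \sum_(0 <= l < j.+1) w l <= x0.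
  apply: leq_trans sum_le.
  by rewrite [leqRHS](big_cat_nat _ (n := j.+1))//= leq_addr.
by rewrite big_nat_recr//=; have := x0_le j; lia.
Qed.

Lemma zigzag_jump j : j < N -> dist (x j.+1) (x j) = w j.
Proof. by move=> /zigzag_ge; rewrite /dist /=; case: ifP => _; lia. Qed.

Lemma zigzag_target j : j < N ->
  dist (x j.+1) (T j) = dist (dist (x j) (T j)) (w j).
Proof. by move=> /zigzag_ge; rewrite /dist /=; case: ifP; lia. Qed.

(** A step turns the distance D to the target into |D - w|. This shrinks by the full step until the
    walk overshoots, and from then on it stays at most [E]. *)
Lemma zigzag_block E c a n : (forall j, j < N -> w j <= E) -> a + n <= N ->
  (forall j, a <= j < a + n -> T j = c) ->
  dist (x (a + n)) c <= maxn E (dist (x a) c - \sum_(a <= j < a + n) w j).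
Proof.
move=> wE; elim: n => [|n IH] anN Tc.
  by rewrite addn0 big_geq// subn0 leq_maxr.
have SE : \sum_(a <= j < (a + n).+1) w j =
    \sum_(a <= j < a + n) w j + w (a + n).
  by rewrite big_nat_recr ?leq_addr.
rewrite addnS SE.
have anN' : a + n < N by lia.
have := zigzag_target anN'; rewrite Tc => [->|]; last by lia.
have := IH _ _; have := wE _ anN'.
have H : a + n <= N by lia.
have H' j : a <= j < a + n -> T j = c by move=> ?; apply: Tc; lia.
move=> wan /(_ H H'); rewrite /dist; lia.
Qed.

End zigzag_theory.

Section refinement.
Context (m d : nat) (u w : nat -> nat) (E J : nat).
Hypothesis w_le : forall j, j < 2 ^ (m + d) -> w j <= E.
Hypothesis sum_w_le : \sum_(0 <= j < 2 ^ (m + d)) w j <= u 0 * 4 ^ d.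
Hypothesis jump_le : forall i, i < 2 ^ m -> dist (u i.+1) (u i) <= J.
Hypothesis sum_w_ge : forall i, i < 2 ^ m ->
  dist (u i.+1) (u i) * 4 ^ d <= \sum_(i * 2 ^ d <= j < i * 2 ^ d + 2 ^ d) w j.

(* On the block of a coarse interval the path heads for the coarse value at
   the right endpoint of that interval. *)
Definition target j := u (j %/ 2 ^ d).+1 * 4 ^ d.
Local Notation x := (zigzag (u 0 * 4 ^ d) w target).

Lemma targetE i j : i * 2 ^ d <= j < i * 2 ^ d + 2 ^ d ->
  target j = u i.+1 * 4 ^ d.
Proof.
move=> ij; rewrite /target; congr (u _.+1 * _).
have -> : j = i * 2 ^ d + (j - i * 2 ^ d) by lia.
by rewrite divnMDl ?expn_gt0// divn_small ?addn0//; lia.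
Qed.

Lemma block_le i : i < 2 ^ m -> i * 2 ^ d + 2 ^ d <= 2 ^ (m + d).
Proof. by move=> im; rewrite addnC -mulSn expnD leq_mul2r im orbT. Qed.

Lemma dist_scaled i : dist (u i * 4 ^ d) (u i.+1 * 4 ^ d) =
  dist (u i.+1) (u i) * 4 ^ d.
Proof. by rewrite /dist mulnDl !mulnBl addnC. Qed.

(** The error does not accumulate: from within [E] of the old left value, the distance to the old
    right value is at most [E] plus the old jump, and by [sum_w_ge] the steps of the block make up
    for that jump. *)
Lemma refinement_coarse i : i <= 2 ^ m ->
  dist (x (i * 2 ^ d)) (u i * 4 ^ d) <= E.
Proof.
elim: i => [|i IH] im; first by rewrite mul0n /dist subnn.
have := zigzag_block sum_w_le w_le (block_le im) (@targetE i).
rewrite mulSn [2 ^ d + _]addnC => /leq_trans; apply; rewrite geq_max leqnn /=.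
have := sum_w_ge im; have := IH (ltnW im).
have := dist_triangle (x (i * 2 ^ d)) (u i * 4 ^ d) (u i.+1 * 4 ^ d).
rewrite dist_scaled; lia.
Qed.

Lemma refinement_fine j : j <= 2 ^ (m + d) ->
  dist (x j) (u (j %/ 2 ^ d) * 4 ^ d) <= E + 2 * J * 4 ^ d.
Proof.
(* The last node lies in no block, but it is an old node. *)
rewrite leq_eqVlt => /predU1P[->|jlt].
  rewrite expnD mulnK ?expn_gt0//; apply: leq_trans (leq_addr _ _).
  exact: refinement_coarse.
pose i := j %/ 2 ^ d; pose k := j %% 2 ^ d.
have k_lt : k < 2 ^ d by rewrite ltn_mod expn_gt0.
have jE : j = i * 2 ^ d + k by exact: divn_eq.
have im : i < 2 ^ m by rewrite ltn_divLR ?expn_gt0// -expnD.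
have kN : i * 2 ^ d + k <= 2 ^ (m + d) by rewrite -jE ltnW.
have Tc l : i * 2 ^ d <= l < i * 2 ^ d + k -> target l = u i.+1 * 4 ^ d.
  by move=> ?; apply: targetE; lia.
have := zigzag_block sum_w_le w_le kN Tc; rewrite -jE -/i.
set S := \sum_(_ <= _ < _) _ => xj.
have := refinement_coarse (ltnW im).
have JJ : dist (u i.+1) (u i) * 4 ^ d <= J * 4 ^ d.
  by rewrite leq_mul2r jump_le ?orbT.
(* The old right value is a detour: heading for it from the start of the block and returning to the
   left value cost [J * 4 ^ d] each, hence the factor 2. *)
have := dist_triangle (x (i * 2 ^ d)) (u i * 4 ^ d) (u i.+1 * 4 ^ d).
have := dist_triangle (x j) (u i.+1 * 4 ^ d) (u i * 4 ^ d).
have := dist_scaled i.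
have -> : dist (u i.+1 * 4 ^ d) (u i * 4 ^ d) =
    dist (u i * 4 ^ d) (u i.+1 * 4 ^ d).
  by rewrite /dist addnC.
by lia.
Qed.

End refinement.

Local Open Scope classical_set_scope.
Local Open Scope ring_scope.

(** * Dyadic points and the existence of the next path *)

Lemma eventually_forall_lt n (P : nat -> nat -> Prop) :
  (forall i, (i < n)%N -> exists N, forall M, (N <= M)%N -> P i M) ->
  exists N, forall M, (N <= M)%N -> forall i, (i < n)%N -> P i M.
Proof.
elim: n => [|n IH] h; first by exists 0%N.
have [i iM|N1 N1P] := IH; first by apply: h; rewrite ltnW.
have [//|N2 N2P] := h n; exists (maxn N1 N2) => M.
rewrite geq_max => /andP[N1M N2M] i; rewrite ltnS leq_eqVlt => /predU1P[->|].
  exact: N2P.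
exact: N1P.
Qed.

Lemma rat_of_codeE a b c :
  rat_of_code (code a b c) = (a%:R - b%:R) / c.+1%:R.
Proof. by rewrite /rat_of_code; have [-> -> ->] := code_logn a b c. Qed.

Section reals.
Context {R : realType}.

Lemma exprn_half_lt (e : R) : 0 < e ->
  exists N, forall M, (N <= M)%N -> 2 ^- M < e.
Proof.
move=> e0; exists (Num.truncn e^-1).+1 => M NM.
rewrite -[e]invrK ltf_pV2 ?posrE ?invr_gt0 ?exprn_gt0//.
apply: lt_le_trans (truncnS_gt e^-1) _.
apply: le_trans (_ : M%:R <= _); first by rewrite ler_nat.
by rewrite -natrX ler_nat ltnW// ltn_expl.
Qed.

Lemma natr_dist x y : (dist x y)%:R = `|x%:R - y%:R| :> R.
Proof.
rewrite /dist; have [xy|yx] := leqP x y.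
  have /eqP -> : (x - y == 0)%N by [].
  by rewrite add0n natrB// distrC ger0_norm// subr_ge0 ler_nat.
have /eqP -> : (y - x == 0)%N by rewrite subn_eq0 ltnW.
by rewrite addn0 natrB 1?ltnW// ger0_norm// subr_ge0 ler_nat ltnW.
Qed.

(** Nonzero steps must be strictly below the increment of f, as only strict inequalities are
    enumerated; zero steps need no confirmation. *)
Lemma exists_strict_floor (y : R) : 0 <= y ->
  exists w : nat, (w = 0%N \/ w%:R < y) /\ y <= w.+1%:R.
Proof.
move=> y0; have /andP[] := truncn_itv y0; set t := Num.truncn y.
rewrite le_eqVlt => /predU1P[ty _|ty yt]; last first.
  by exists t; split; [right|exact: ltW].
case: t ty => [|t] ty; first by exists 0%N; split; [left|rewrite -ty].
by exists t; split; [right; rewrite -ty ltr_nat|rewrite ty].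
Qed.

Definition pt m i : R := i%:R / 2 ^+ m.

Lemma pt_scale m d i : pt (m + d) (i * 2 ^ d) = pt m i.
Proof.
rewrite /pt exprD natrM natrX -mulf_div divff ?mulr1//.
Qed.

Lemma pt0 m : pt m 0 = 0. Proof. by rewrite /pt mul0r. Qed.

Lemma pt1 m : pt m (2 ^ m) = 1.
Proof. by rewrite /pt natrX divff// expf_neq0// pnatr_eq0. Qed.

Lemma ler_pt m i j : (pt m i <= pt m j) = (i <= j)%N.
Proof. by rewrite /pt ler_pM2r ?invr_gt0 ?exprn_gt0// ler_nat. Qed.

Lemma pt_itv m i : (i <= 2 ^ m)%N -> pt m i \in `[0, 1].
Proof. by move=> im; rewrite in_itv/= -(pt0 m) -(pt1 m) !ler_pt im. Qed.

Lemma ratr_code i m :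
  ratr (rat_of_code (code i 0 (2 ^ m).-1)) = pt m i :> R.
Proof.
rewrite rat_of_codeE subr0 prednK ?expn_gt0// rmorphM/= fmorphV/= !ratr_nat.
by rewrite natrX.
Qed.

Lemma ratr_code4 i m :
  ratr (rat_of_code (code i 0 (4 ^ m).-1)) = i%:R / 4 ^+ m :> R.
Proof.
rewrite rat_of_codeE subr0 prednK ?expn_gt0// rmorphM/= fmorphV/= !ratr_nat.
by rewrite natrX.
Qed.

Definition enumerates (f : R -> R) (e0 e1 e2 : nat -> nat) : Prop :=
  forall c0 c1 c2 : nat,
    (exists n, [/\ e0 n = c0, e1 n = c1 & e2 n = c2]) <->
    [/\ 0 <= rat_of_code c1, rat_of_code c1 < rat_of_code c2,
        rat_of_code c2 <= 1 &
        ratr (rat_of_code c0) <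
          f (ratr (rat_of_code c2)) - f (ratr (rat_of_code c1))].

Section existence.
Context (f : R -> R) (C : nat) (e0 e1 e2 : nat -> nat).
Hypothesis f0 : f 0 = 0.
Hypothesis f_nondecreasing : {in `[0, 1] &, {homo f : x y / x <= y}}.
Hypothesis f_mesh : forall e, 0 < e -> exists N, forall M, (N <= M)%N ->
  forall i, (i < 2 ^ M)%N -> f (pt M i.+1) - f (pt M i) <= e.
Hypothesis f_le_C : f 1 <= C%:R.
Hypothesis enumP : enumerates f e0 e1 e2.

Lemma witnessedP m a i : (i < 2 ^ m)%N ->
  (exists n, witnessed e0 e1 e2 m a i n) <->
  a%:R / 4 ^+ m < f (pt m i.+1) - f (pt m i).
Proof.
move=> im; have := enumP (code a 0 (4 ^ m).-1) (code i 0 (2 ^ m).-1)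
  (code i.+1 0 (2 ^ m).-1).
rewrite !ratr_code ratr_code4 !rat_of_codeE !subr0 prednK ?expn_gt0//.
have -> : 0 <= i%:R / (2 ^ m)%:R :> rat by rewrite divr_ge0 ?ler0n.
have P0 : 0 < (2 ^ m)%:R :> rat by rewrite ltr0n expn_gt0.
have -> : i%:R / (2 ^ m)%:R < i.+1%:R / (2 ^ m)%:R :> rat.
  by rewrite ltr_pM2r ?invr_gt0// ltr_nat.
have -> : i.+1%:R / (2 ^ m)%:R <= 1 :> rat.
  by rewrite ler_pdivrMr// mul1r ler_nat.
move=> H; split=> [[n /and3P[/eqP h0 /eqP h1 /eqP h2]]|h].
  by have [] := (H.1 (ex_intro _ n (And3 h0 h1 h2))).
have [n [h0 h1 h2]] := H.2 (And4 isT isT isT h).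
by exists n; rewrite /witnessed h0 h1 h2 !eqxx.
Qed.

Lemma rat_of_code1 : rat_of_code 1 = 0.
Proof. by rewrite (rat_of_codeE 0 0 0) subr0 mul0r. Qed.

Lemma rat_of_code2 : rat_of_code 2 = 1.
Proof. by rewrite (rat_of_codeE 1 0 0) subr0 divr1. Qed.

Lemma enum01P c0 : (exists s, [/\ e0 s = c0, e1 s = 1%N & e2 s = 2%N]) <->
  ratr (rat_of_code c0) < f 1.
Proof.
have := enumP c0 1 2; rewrite rat_of_code1 rat_of_code2 rmorph0 rmorph1 f0.
by rewrite subr0 lexx ltr01 lexx => -[h1 h2]; split=> [/h1[]//|?]; exact: h2.
Qed.

Lemma valid_jump s r i : valid C e0 e1 e2 s r -> (i < 2 ^ lev r)%N ->
  (jump r i * 2 ^ s <= 4 ^ lev r)%N /\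
  (jump r i = 0%N \/
   (jump r i)%:R / 4 ^+ lev r < f (pt (lev r) i.+1) - f (pt (lev r) i)).
Proof.
move=> /andP[_ /allP/(_ i)]; rewrite mem_iota => + im => /(_ im)/andP[-> J].
split=> //; case/orP: J => [/eqP|/hasP[n _ wn]]; [by left|right].
by apply/witnessedP => //; exists n.
Qed.

(** The steps are strict floors of the increments of f in units of 4^-M. Rounding loses at most one
    unit per interval, hence at most 2^-M in all, which the slack in finitely many strict
    inequalities absorbs once M is large. *)
Lemma exists_refinement s r : valid C e0 e1 e2 s r ->
  exists n, valid C e0 e1 e2 s.+1 n && refines e0 e1 e2 s r n.
Proof.
move=> vr; set m := lev r.
pose D M i := f (pt M i.+1) - f (pt M i).
have D_ge0 M i : (i < 2 ^ M)%N -> 0 <= D M i.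
  move=> iM; rewrite subr_ge0 f_nondecreasing ?pt_itv// ?ler_pt//.
  exact: ltnW.
have D_sum M a b : (a <= b)%N ->
    \sum_(a <= j < b) D M j = f (pt M b) - f (pt M a).
  by move=> ab; rewrite telescope_sumr.
have four_gt0 M : 0 < 4 ^+ M :> R by rewrite exprn_gt0.
have four_half M : 4 ^+ M * 2 ^- M = 2 ^+ M :> R.
  have -> : 4 = 2 * 2 :> R by rewrite -natrM.
  by rewrite exprMn mulfK// expf_neq0// pnatr_eq0.
(* Steps this small meet both the step bound of stage s+1 and the tolerance at old nodes. *)
have [N1 N1P] : exists N, forall M, (N <= M)%N -> forall i, (i < 2 ^ M)%N ->
    D M i <= 2 ^- (s + m).+1.
  by apply: f_mesh; rewrite invr_gt0 exprn_gt0.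
(* A nonzero old jump is strictly below the increment of f, so fine grids leave room for the
   rounding losses in its block. *)
have [N2 N2P] : exists N, forall M, (N <= M)%N -> forall i, (i < 2 ^ m)%N ->
    jump r i = 0%N \/ (jump r i)%:R / 4 ^+ m + 2 ^- M <= D m i.
  apply: eventually_forall_lt => i im.
  have [_ [J0|JD]] := valid_jump vr im; first by exists 0%N => M _; left.
  have [|N NP] := @exprn_half_lt (D m i - (jump r i)%:R / 4 ^+ m).
    by rewrite subr_gt0.
  by exists N => M /NP; rewrite ltrBrDl => /ltW; right.
(* If the s-th triple is (q, 0, 1), there is similar room between q and [f 1]. *)
have [N3 N3P] : exists N, forall M, (N <= M)%N ->
    e1 s = 1%N -> e2 s = 2%N -> ratr (rat_of_code (e0 s)) + 2 ^- M <= f 1.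
  have [e12|ne12] := pselect (e1 s = 1%N /\ e2 s = 2%N); last first.
    by exists 0%N => M _ h1 h2; case: ne12.
  have q1 : ratr (rat_of_code (e0 s)) < f 1.
    by apply/enum01P; exists s; case: e12.
  have [|N NP] := @exprn_half_lt (f 1 - ratr (rat_of_code (e0 s))).
    by rewrite subr_gt0.
  by exists N => M /NP; rewrite ltrBrDl => /ltW.
(* The successor makes the level grow strictly. *)
pose d := (N1 + N2 + N3).+1.
have M1 : (N1 <= m + d)%N by rewrite /d; lia.
have M2 : (N2 <= m + d)%N by rewrite /d; lia.
have M3 : (N3 <= m + d)%N by rewrite /d; lia.
have /choice[w wP] : forall j, exists w : nat, (j < 2 ^ (m + d))%N ->
    (w = 0%N \/ w%:R < 4 ^+ (m + d) * D (m + d)%N j) /\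
    4 ^+ (m + d) * D (m + d)%N j <= w.+1%:R.
  move=> j; have [jM|jM] := ltnP j (2 ^ (m + d)); last by exists 0%N.
  have [|w wP] := @exists_strict_floor (4 ^+ (m + d) * D (m + d)%N j).
    by rewrite mulr_ge0 ?D_ge0// ltW.
  by exists w.
have w_leD j : (j < 2 ^ (m + d))%N -> (w j)%:R <= 4 ^+ (m + d) * D (m + d)%N j.
  move=> jM; have [[->|/ltW//] _] := wP j jM.
  by rewrite mulr_ge0 ?D_ge0// ltW.
have w_sum_ge a b : (a <= b)%N -> (b <= 2 ^ (m + d))%N ->
    4 ^+ (m + d) * (f (pt (m + d) b) - f (pt (m + d) a)) - (b - a)%N%:R
    <= (\sum_(a <= j < b) w j)%N%:R.
  move=> ab bM; rewrite -D_sum// lerBlDr mulr_sumr.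
  have -> : (b - a)%N%:R = \sum_(a <= j < b) 1 :> R.
    by rewrite sumr_const_nat.
  rewrite natr_sum -big_split/= !big_nat; apply: ler_sum => j /andP[_ jb].
  by have [_] := wP j (leq_trans jb bM); rewrite -[(w j).+1%:R]natr1.
set M := (m + d)%N in M1 M2 M3 wP w_leD w_sum_ge *.
have u0E : val_at r 0 = (C * 4 ^ m)%N by case/andP: vr => /eqP.
pose E := (4 ^ M %/ 2 ^ (s + m).+1)%N; pose J := (4 ^ m %/ 2 ^ s)%N.
have w_small j : (j < 2 ^ M)%N -> (w j <= E)%N.
  move=> jM; rewrite /E leq_divRL ?expn_gt0// -(ler_nat R) natrM !natrX.
  rewrite -ler_pdivlMr ?exprn_gt0// (le_trans (w_leD j jM))//.
  by rewrite ler_pM2l// N1P.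
(* The steps total at most 4^M times [f 1], and [f 1 <= C], so the starting height suffices. *)
have w_sum_le : (\sum_(0 <= j < 2 ^ M) w j <= val_at r 0 * 4 ^ d)%N.
  rewrite u0E -mulnA -expnD -/M -(ler_nat R) natr_sum natrM natrX.
  apply: (@le_trans _ _ (\sum_(0 <= j < 2 ^ M) 4 ^+ M * D M j)).
    by rewrite !big_nat; apply: ler_sum => j /andP[_ /w_leD].
  by rewrite -mulr_sumr D_sum// pt0 pt1 f0 subr0 mulrC ler_pM2r.
have jump_small i : (i < 2 ^ m)%N -> (dist (val_at r i.+1) (val_at r i) <= J)%N.
  by move=> im; rewrite leq_divRL ?expn_gt0//; have [] := valid_jump vr im.
have w_block i : (i < 2 ^ m)%N -> (dist (val_at r i.+1) (val_at r i) * 4 ^ d <=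
    \sum_(i * 2 ^ d <= j < i * 2 ^ d + 2 ^ d) w j)%N.
  move=> im; rewrite -/(jump r i).
  have [->//|JD] := N2P _ M2 _ im.
  rewrite -(ler_nat R); apply: le_trans (w_sum_ge _ _ _ _); last 2 first.
  - exact: leq_addr.
  - exact: block_le.
  rewrite -mulSnr /M !pt_scale -/(D m i) mulSnr addKn natrM !natrX.
  rewrite lerBrDr.
  apply: le_trans (_ : 4 ^+ M * ((jump r i)%:R / 4 ^+ m + 2 ^- M) <= _).
    rewrite mulrDr four_half lerD//; last first.
      by rewrite ler_weXn2l ?ler1n// leq_addl.
    by rewrite exprD -mulrA [4 ^+ d * _]mulrC mulrA
      [_ * (_ / _)]mulrC divfK// gt_eqF.
  by rewrite ler_pM2l.
have /choice[wit witP] : forall j, exists n, (j < 2 ^ M)%N -> w j <> 0%N ->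
    witnessed e0 e1 e2 M (w j) j n.
  move=> j; have [jM|jM] := ltnP j (2 ^ M); last by exists 0%N.
  have [[w0|wD] _] := wP j jM; first by exists 0%N.
  have [n wn] : exists n, witnessed e0 e1 e2 M (w j) j n.
    by apply/witnessedP => //; rewrite ltr_pdivrMr// mulrC.
  by exists n.
pose x := zigzag (val_at r 0 * 4 ^ d) w (target d (val_at r)).
(* The sum of the indices exceeds none of its terms from below, so its successor is a valid search
   bound for all of them. *)
have [n [levn bndn valn]] :=
  exists_state M (\sum_(0 <= j < 2 ^ M) wit j).+1 x (2 ^ M).+1.
have jumpn j : (j < 2 ^ M)%N -> jump n j = w j.
  by move=> jM; rewrite /jump !valn// 1?ltnW// (zigzag_jump _ w_sum_le).
have fine := refinement_fine w_small w_sum_le jump_small w_block.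
have coarse := refinement_coarse w_small w_sum_le w_block.
have EM : (2 ^ (s + m).+1 * E <= 4 ^ M)%N by rewrite mulnC leq_divM.
have Mm : (M - m = d)%N by rewrite /M addKn.
exists n; rewrite /valid /refines levn -/m Mm; apply/and5P; split.
- rewrite valn// {1}/x /= u0E -mulnA -expnD -/M eqxx /=.
  apply/allP => j; rewrite mem_iota add0n => /= jM; rewrite jumpn//.
  apply/andP; split.
    apply: leq_trans EM; rewrite mulnC leq_mul ?w_small// leq_exp2l//.
    by rewrite ltnS leq_addr.
  have [->//|/eqP wj0] := eqVneq (w j) 0%N; apply/hasP.
  exists (wit j); last exact: witP.
  rewrite mem_iota add0n; apply: leq_trans bndn; rewrite ltnS.
  by rewrite (bigD1_seq j) ?mem_index_iota ?iota_uniq//= leq_addr.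
- by rewrite /M /d; lia.
- apply/allP => i; rewrite mem_iota add0n => /= im.
  rewrite valn; last by rewrite ltnS /M expnD leq_mul2r -ltnS im orbT.
  apply: leq_trans EM; rewrite leq_mul//; last exact: coarse.
  by rewrite leq_exp2l.
- apply/allP => j; rewrite mem_iota add0n => /= jM; rewrite valn//.
  (* The 3 in [refines] is one share for [E] and two for [J]. *)
  apply: (@leq_trans (2 ^ s * (E + 2 * J * 4 ^ d))).
    by rewrite leq_mul2l fine ?orbT.
  have sE : (2 ^ s * E <= 4 ^ M)%N.
    apply: leq_trans EM; rewrite leq_mul2r leq_exp2l// leqW ?orbT//.
    exact: leq_addr.
  have sJ : (2 ^ s * J * 4 ^ d <= 4 ^ M)%N.
    by rewrite /M expnD leq_mul2r mulnC leq_divM orbT.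
  by move: sE sJ; rewrite mulnDr; lia.
- apply/implyP => /andP[/eqP h1 /eqP h2].
  have -> : (\sum_(0 <= j < 2 ^ M) jump n j = \sum_(0 <= j < 2 ^ M) w j)%N.
    by rewrite !big_nat; apply: eq_bigr => j /andP[_ /jumpn].
  have := w_sum_ge 0%N (2 ^ M)%N (leq0n _) (leqnn _).
  rewrite pt0 pt1 f0 !subr0 subn0 natrX => V1.
  have := N3P _ M3 h1 h2; rewrite -(ler_pM2l (four_gt0 M)) mulrDr four_half.
  rewrite /rat_of_code rmorphM fmorphV/= rmorphB/= !ratr_nat => V2.
  have {V1 V2} V3 := le_trans (lerD V2 (lexx (- 2 ^+ M))) V1.
  rewrite addrK mulrA ler_pdivrMr ?ltr0n// in V3.
  by rewrite -(ler_nat R) natrD !natrM !natrX -lerBlDr -mulrBl mulrC.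
Qed.

End existence.
End reals.

(** * The limit function and its variation *)

Section analysis.
Context {R : realType}.

(** Heine's theorem from the near-covering form of compactness: half the radius that serves e/2 at x
    works for all points near x. *)
Lemma uniform_continuity_segment (f : R -> R) :
  {within `[0, 1], continuous f} -> forall e : R, 0 < e ->
  exists2 del, 0 < del & forall x y : R, x \in `[0, 1] -> y \in `[0, 1] ->
    `|x - y| < del -> `|f x - f y| < e.
Proof.
move=> fc e e0.
pose P (del x : R) := forall y : R,
  y \in `[0, 1] -> `|x - y| < del -> x \in `[0, 1] -> `|f x - f y| < e.
have : \forall del \near 0^'+, forall x, `[0, 1]%classic x -> P del x.
  have := (compact_near_coveringP _).1 (@segment_compact R 0 1).
  move=> /(_ _ (0^'+) P _); apply => x x01.
  have /cvgrPdist_lt/(_ (e / 2)) : f @ (within `[0, 1] (nbhs x)) --> f x.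
    by move/subspace_continuousP : fc; apply.
  rewrite divr_gt0// => /(_ isT) /nbhs_ballP[r /= r0 rP].
  have rP' y : y \in `[0, 1] -> `|x - y| < r -> `|f x - f y| < e / 2.
    by move=> y01 xy; apply: rP.
  near=> x' del => y y01 /= x'y x'01.
  have xx' : `|x - x'| < r / 2.
    by near: x'; exists (r / 2) => //=; rewrite divr_gt0.
  have delr : del < r / 2 by near: del; apply: nbhs_right_lt; rewrite divr_gt0.
  have xy : `|x - y| < r by have := ler_distD x' x y; lra.
  have xx'r : `|x - x'| < r by lra.
  have := rP' _ x'01 xx'r; have := rP' _ y01 xy.
  have := ler_distD (f x) (f x') (f y).
  rewrite [`|f x' - f x|]distrC; lra.
move=> h; have : \forall del \near 0^'+,
    0 < del /\ forall x, `[0, 1]%classic x -> P del x.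
  by near=> del; split; [near: del; exact: nbhs_right_gt|near: del].
move=> /filter_ex[del [del0 delP]]; exists del => // x y x01 y01 xy.
exact: delP.
Unshelve. all: by end_near. Qed.

Lemma ler0_half (a c : R) : (forall k, a <= c * 2 ^- k) -> a <= 0.
Proof.
move=> h; rewrite leNgt; apply/negP => a0.
have c0 : 0 < c by have := h 0%N; rewrite expr0 invr1 mulr1; exact: lt_le_trans.
have [|k /(_ k (leqnn k))] := @exprn_half_lt R (a / c).
  by rewrite divr_gt0.
by rewrite ltr_pdivlMr// mulrC ltNge h.
Qed.

Lemma geometric_limit (z : nat -> R) c :
  (forall s, `|z s.+1 - z s| <= c * 2 ^- s) ->
  exists l, forall s, `|l - z s| <= 2 * c * 2 ^- s.
Proof.
move=> zc.
have half k : 2 ^- k.+1 = 2 ^- k / 2 :> R by rewrite exprSr invfM mulrC.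
have zz s k : `|z (s + k)%N - z s| <= 2 * c * 2 ^- s - 2 * c * 2 ^- (s + k).
  elim: k => [|k IH]; first by rewrite addn0 !subrr normr0.
  rewrite addnS half; have := ler_distD (z (s + k)%N) (z (s + k).+1) (z s).
  have := zc (s + k)%N; lra.
have c0 : 0 <= c.
  by have := zc 0%N; rewrite expr0 invr1 mulr1; apply: le_trans.
have p0 k : 0 <= c * 2 ^- k by rewrite mulr_ge0// invr_ge0 exprn_ge0.
(* Every lower estimate is below every upper one, so the supremum of the lower ones obeys all
   bounds; the factor 2 sums the geometric series. *)
pose A := range (fun s => z s - 2 * c * 2 ^- s).
have ubA t : ubound A (z t + 2 * c * 2 ^- t).
  move=> _ [s _ <-]; have [st|ts] := leqP s t.
    have := zz s (t - s)%N; rewrite subnKC// ler_norml => /andP[+ _].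
    have := p0 s; have := p0 t; lra.
  have := zz t (s - t)%N; rewrite subnKC 1?ltnW// ler_norml => /andP[_].
  have := p0 s; have := p0 t; lra.
exists (sup A) => s; rewrite ler_distl; apply/andP; split.
  apply: sup_upper_bound; last by exists s.
  split; first by exists (z 0%N - 2 * c * 2 ^- 0), 0%N.
  by exists (z 0%N + 2 * c * 2 ^- 0); exact: ubA.
by apply: sup_le_ub => //; exists (z 0%N - 2 * c * 2 ^- 0), 0%N.
Qed.

Lemma truncn_scale (x : R) m d : 0 <= x ->
  (Num.truncn (x * 2 ^+ (m + d)) %/ 2 ^ d)%N = Num.truncn (x * 2 ^+ m).
Proof.
move=> x0; have p0 k : 0 < 2 ^+ k :> R by exact: exprn_gt0.
apply/esym/eqP; rewrite truncn_eq; last by rewrite mulr_ge0// ltW.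
have /andP[t1 t2] := @truncn_itv R (x * 2 ^+ (m + d))
  (mulr_ge0 x0 (ltW (p0 _))).
set t := Num.truncn _ in t1 t2 *.
rewrite -(ler_pM2r (p0 d)) -(ltr_pM2r (p0 d)) -mulrA -exprD.
apply/andP; split.
  apply: le_trans t1; rewrite -natrX -natrM ler_nat; exact: leq_divM.
apply: lt_le_trans t2 _; rewrite -natrX -natrM ler_nat.
by rewrite ltn_ceil// expn_gt0.
Qed.

Lemma truncn_pt m i : Num.truncn (pt m i * 2 ^+ m : R) = i.
Proof. by rewrite /pt divfK ?natrK// gt_eqF// exprn_gt0. Qed.

End analysis.

Section limit.
Context {R : realType} (f : R -> R) (C : nat) (e0 e1 e2 : nat -> nat).
Hypothesis f0 : f 0 = 0.
Hypothesis f_nondecreasing : {in `[0, 1] &, {homo f : x y / x <= y}}.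
Hypothesis f_uniform : forall e : R, 0 < e ->
  exists2 del, 0 < del & forall x y : R, x \in `[0, 1] -> y \in `[0, 1] ->
    `|x - y| < del -> `|f x - f y| < e.
Hypothesis enumP : enumerates f e0 e1 e2.
Context (st : nat -> nat).
Hypothesis st_valid : forall s, valid C e0 e1 e2 s (st s).
Hypothesis st_refines : forall s, refines e0 e1 e2 s (st s) (st s.+1).

Local Notation m s := (lev (st s)).

(** At x = 1 the index is [2 ^ m s], the node after the last interval. *)
Definition approx s (x : R) : R :=
  (val_at (st s) (Num.truncn (x * 2 ^+ m s)))%:R / 4 ^+ m s.

Let two_gt0 k : 0 < 2 ^+ k :> R. Proof. exact: exprn_gt0. Qed.
Let four_gt0 k : 0 < 4 ^+ k :> R. Proof. exact: exprn_gt0. Qed.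

Lemma lev_mono s r : (s <= r)%N -> (m s <= m r)%N.
Proof.
move=> /subnKC <-; elim: (r - s)%N => [|k IH]; first by rewrite addn0.
by rewrite addnS; apply: leq_trans IH _;
  case/and4P: (st_refines (s + k)) => /ltnW.
Qed.

Lemma lev_ge s : (s <= m s)%N.
Proof.
elim: s => // s IH; apply: leq_ltn_trans IH _.
by case/and4P: (st_refines s).
Qed.

Lemma truncn_itv01 (x : R) M :
  x \in `[0, 1] -> (Num.truncn (x * 2 ^+ M) <= 2 ^ M)%N.
Proof.
rewrite in_itv => /andP[x0 x1].
rewrite -(ler_nat R) natrX; apply: le_trans (_ : x * 2 ^+ M <= _).
  by rewrite truncn_le mulr_ge0// ltW.
by rewrite ler_piMl// ltW.
Qed.

Lemma dist_real s a b d : (4 ^+ (m s + d))^-1 * (dist a (b * 4 ^ d))%:R =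
  `|a%:R / 4 ^+ (m s + d) - b%:R / 4 ^+ m s| :> R.
Proof.
have -> : b%:R / 4 ^+ m s = b%:R * 4 ^+ d / 4 ^+ (m s + d) :> R.
  by rewrite exprD -mulf_div divff ?mulr1// gt_eqF.
rewrite natr_dist natrM natrX -mulrBl normrM mulrC.
by rewrite [`|_^-1|]ger0_norm// invr_ge0 ltW.
Qed.

Lemma approx_step s x : x \in `[0, 1] ->
  `|approx s.+1 x - approx s x| <= 3 * 2 ^- s.
Proof.
move=> x01.
have /and4P[mlt _ /allP/(_ (Num.truncn (x * 2 ^+ m s.+1))) + _] :=
  st_refines s.
rewrite mem_iota add0n ltnS truncn_itv01// => /(_ isT).
have mE : m s.+1 = (m s + (m s.+1 - m s))%N by rewrite subnKC// ltnW.
set d := (m s.+1 - m s)%N in mE *.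
have x0 : 0 <= x by move: x01; rewrite in_itv => /andP[].
rewrite /approx mE truncn_scale// -dist_real.
rewrite -(ler_nat R) !natrM !natrX => h.
rewrite mulrC ler_pdivrMr// -(ler_pM2l (two_gt0 s)) (le_trans h)//.
by rewrite [3 / _]mulrC mulrA mulVKf// gt_eqF.
Qed.

Lemma approx_pt s i : approx s (pt (m s) i) = (val_at (st s) i)%:R / 4 ^+ m s.
Proof. by rewrite /approx truncn_pt. Qed.

Lemma approx_step_pt s i : (i <= 2 ^ m s)%N ->
  `|approx s.+1 (pt (m s) i) - approx s (pt (m s) i)| <= 2 ^- (s + m s).
Proof.
move=> im; have /and4P[mlt /allP/(_ i) + _ _] := st_refines s.
rewrite mem_iota add0n ltnS im => /(_ isT).
have mE : m s.+1 = (m s + (m s.+1 - m s))%N by rewrite subnKC// ltnW.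
set d := (m s.+1 - m s)%N in mE *.
rewrite approx_pt -[in approx s.+1 _](pt_scale (m s) d) -mE approx_pt mE.
rewrite -dist_real.
rewrite -(ler_nat R) !natrM !natrX => h.
by rewrite mulrC ler_pdivrMr// -(ler_pM2l (two_gt0 (s + m s))) mulVKf ?gt_eqF.
Qed.

Lemma exists_limit : exists g : R -> R, forall x, x \in `[0, 1] -> forall s,
  `|g x - approx s x| <= 6 * 2 ^- s.
Proof.
have /choice[g gP] : forall x, exists l, x \in `[0, 1] -> forall s,
    `|l - approx s x| <= 6 * 2 ^- s.
  move=> x; have [x01|nx01] := boolP (x \in `[0, 1]); last by exists 0.
  have [l lP] := @geometric_limit R (approx^~ x) 3 (fun s => approx_step s x01).
  by exists l => _ s; have := lP s; rewrite -natrM.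
by exists g.
Qed.

Lemma jump_le s i : (i < 2 ^ m s)%N ->
  `|approx s (pt (m s) i.+1) - approx s (pt (m s) i)| <=
    f (pt (m s) i.+1) - f (pt (m s) i).
Proof.
move=> im; rewrite !approx_pt -mulrBl normrM -natr_dist.
rewrite [`|_^-1|]ger0_norm ?invr_ge0 ?(ltW (four_gt0 _))//.
have [_ [J0|/ltW//]] := valid_jump enumP (st_valid s) im.
rewrite -/(jump (st s) i) J0 mul0r subr_ge0 f_nondecreasing ?pt_itv ?ler_pt//.
exact: ltnW.
Qed.

Lemma jump_small s i : (i < 2 ^ m s)%N ->
  `|approx s (pt (m s) i.+1) - approx s (pt (m s) i)| <= 2 ^- s.
Proof.
move=> im; rewrite !approx_pt -mulrBl normrM -natr_dist.
rewrite [`|_^-1|]ger0_norm ?invr_ge0 ?(ltW (four_gt0 _))//.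
have [+ _] := valid_jump enumP (st_valid s) im.
rewrite -(ler_nat R) natrM !natrX => h.
by rewrite ler_pdivrMr// mulrC ler_pdivlMr.
Qed.

Definition floor_pt s (x : R) : R := pt (m s) (Num.truncn (x * 2 ^+ m s)).

Lemma approx_floor s x : approx s x = approx s (floor_pt s x).
Proof. by rewrite /approx truncn_pt. Qed.

Lemma floor_pt_itv s x : x \in `[0, 1] -> floor_pt s x \in `[0, 1].
Proof. by move=> x01; rewrite pt_itv// truncn_itv01. Qed.

Lemma floor_pt_bounds s x : x \in `[0, 1] ->
  floor_pt s x <= x < floor_pt s x + 2 ^- m s.
Proof.
rewrite in_itv => /andP[x0 _].
have /andP[] := @truncn_itv R (x * 2 ^+ m s) (mulr_ge0 x0 (ltW (two_gt0 _))).
rewrite /floor_pt /pt; set t := Num.truncn _.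
rewrite -[t.+1%:R]natr1 => h1 h2; apply/andP; split.
  by rewrite ler_pdivrMr.
by rewrite -[X in _ + X]mul1r -mulrDl ltr_pdivlMr.
Qed.

Lemma approx_pt_variation s i j : (i <= j)%N -> (j <= 2 ^ m s)%N ->
  `|approx s (pt (m s) j) - approx s (pt (m s) i)| <=
    f (pt (m s) j) - f (pt (m s) i).
Proof.
move=> /subnKC <-; elim: (j - i)%N => [|k IH] jm.
  by rewrite addn0 !subrr normr0.
rewrite addnS in jm *.
have := IH (ltnW jm); have := jump_le jm.
have := ler_distD (approx s (pt (m s) (i + k))) (approx s (pt (m s) (i + k).+1))
  (approx s (pt (m s) i)); lra.
Qed.

Section with_limit.
Context (g : R -> R).
Hypothesis gP : forall x, x \in `[0, 1] -> forall s,
  `|g x - approx s x| <= 6 * 2 ^- s.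

(** A node of stage s is a node of all later grids, so the sharper tolerance at old nodes applies
    forever. The error is small enough to be summed over all [2 ^ m s] intervals. *)
Lemma limit_pt s i : (i <= 2 ^ m s)%N ->
  `|g (pt (m s) i) - approx s (pt (m s) i)| <= 2 * 2 ^- (s + m s).
Proof.
move=> im; set p := pt (m s) i.
have p01 : p \in `[0, 1] by exact: pt_itv.
have [k|l lP] :=
  @geometric_limit R (fun k => approx (s + k) p) (2 ^- (s + m s)).
  have ms : (m s <= m (s + k))%N by apply: lev_mono; exact: leq_addr.
  have pE : p = pt (m (s + k)) (i * 2 ^ (m (s + k) - m s)).
    by rewrite /p -[in LHS](pt_scale _ (m (s + k) - m s)) subnKC.
  rewrite addnS pE; apply: le_trans (approx_step_pt _) _.
    by rewrite -[in leqRHS](subnKC ms) expnD leq_mul2r im orbT.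
  rewrite -invfM -exprD lef_pV2 ?posrE// ler_weXn2l ?ler1n//.
  by rewrite addnAC leq_add2l.
(* Both are limits of the same sequence of approximations. *)
have <- : l = g p; last by have := lP 0%N; rewrite addn0 expr0 invr1 mulr1.
apply/eqP; rewrite -subr_eq0 -normr_le0.
apply: (@ler0_half _ _ (2 * 2 ^- (s + m s) + 6)) => k; rewrite mulrDl.
have := ler_distD (approx (s + k) p) l (g p).
have := lP k; have := gP p01 (s + k).
rewrite [`|approx _ _ - g p|]distrC.
have : 2 ^- (s + k) <= 2 ^- k :> R.
  by rewrite lef_pV2 ?posrE// ler_weXn2l ?ler1n// leq_addl.
lra.
Qed.

(** The grid estimate passes to the limit: rounding y down only decreases f, and uniform continuity
    absorbs the rounding of x. *)
Lemma limit_variation x y : x \in `[0, 1] -> y \in `[0, 1] -> x <= y ->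
  `|g y - g x| <= f y - f x.
Proof.
move=> x01 y01 xy; apply/ler_addgt0Pr => e e_gt0.
have e_half : 0 < e / 2 by rewrite divr_gt0.
have [del del0 delP] := f_uniform e_half.
have [N1 N1P] := exprn_half_lt del0.
(* Two limit errors of 6 * 2^-s then stay below e/2. *)
have [N2 N2P] : exists N, forall M, (N <= M)%N -> 2 ^- M < e / 24 :> R.
  by apply: exprn_half_lt; rewrite divr_gt0.
pose s := maxn N1 N2.
have := gP x01 s; have := gP y01 s; have := N2P s (leq_maxr _ _).
have /andP[xl xu] := floor_pt_bounds s x01.
have /andP[yl _] := floor_pt_bounds s y01.
have xd : `|x - floor_pt s x| < del.
  rewrite ger0_norm ?subr_ge0//; apply: lt_trans (N1P (m s) _).
    by rewrite ltrBlDl.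
  by apply: leq_trans (lev_ge s); exact: leq_maxl.
have := delP _ _ x01 (floor_pt_itv s x01) xd.
have := f_nondecreasing (floor_pt_itv s y01) y01 yl.
have : `|approx s y - approx s x| <= f (floor_pt s y) - f (floor_pt s x).
  rewrite (approx_floor s y) (approx_floor s x).
  rewrite approx_pt_variation ?truncn_itv01//.
  by rewrite le_truncn// ler_pM2r.
have := ler_distD (approx s y) (g y) (g x).
have := ler_distD (approx s x) (approx s y) (g x).
rewrite [`|approx s x - g x|]distrC; have := ler_norm (f x - f (floor_pt s x)).
lra.
Qed.

(** Points closer than the mesh lie in the same or adjacent intervals, where the approximation
    changes by at most 2^-s. With two limit errors this makes 13 * 2^-s, below 16 * 2^-s = 2^-n;
    hence n + 4. *)
Lemma limit_modulus n x y : x \in `[0, 1] -> y \in `[0, 1] ->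
  `|x - y| < 2 ^- m (n + 4) -> `|g x - g y| < 2 ^- n.
Proof.
wlog xy : x y / x <= y.
  move=> W x01 y01 dxy; have [|/ltW] := leP x y; first by move/W; apply.
  by move=> yx; rewrite distrC W// distrC.
move=> x01 y01; set s := (n + 4)%N => dxy.
have : `|approx s y - approx s x| <= 2 ^- s.
  have /andP[xl xu] := floor_pt_bounds s x01.
have /andP[yl yu] := floor_pt_bounds s y01.
  pose i := Num.truncn (x * 2 ^+ m s); pose j := Num.truncn (y * 2 ^+ m s).
  have ij : (i <= j)%N by rewrite le_truncn// ler_pM2r.
  have ji : (j <= i.+1)%N.
    rewrite -ltnS -(ltr_nat R) -(ltr_pM2r (x := 2 ^- m s)) ?invr_gt0//.
    rewrite -[i.+2%:R]natr1 -[i.+1%:R]natr1 !mulrDl !mul1r.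
    move: xl xu yl yu dxy; rewrite /floor_pt /pt -/i -/j.
    rewrite ler0_norm ?subr_le0// opprB; lra.
  rewrite (approx_floor s y) (approx_floor s x) /floor_pt -/i -/j.
  have [->|ne] := eqVneq i j; first by rewrite subrr normr0 invr_ge0 ltW.
  have jE : j = i.+1 by apply/eqP; rewrite eqn_leq ji ltn_neqAle ne.
  by rewrite jE jump_small// -jE truncn_itv01.
have := gP x01 s; have := gP y01 s.
have := ler_distD (approx s y) (g y) (g x).
have := ler_distD (approx s x) (approx s y) (g x).
rewrite [`|approx s x - g x|]distrC [`|g x - g y|]distrC.
have -> : 2 ^- s = 2 ^- n / 16 :> R.
  by rewrite /s exprD invfM; congr (_ * _^-1); rewrite -natrX.
have : 0 < 2 ^- n :> R by rewrite invr_gt0.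
lra.
Qed.

(** Along any partition a monotone f has variation exactly [f y - f x], so comparing term by term
    suffices. *)
Lemma total_variation_limit_le x y : x \in `[0, 1] -> y \in `[0, 1] -> x <= y ->
  (total_variation x y g <= (f y - f x)%:E)%E.
Proof.
move=> x01 y01 xy.
have sub z : z \in `[x, y] -> z \in `[0, 1].
  move: x01 y01; rewrite !in_itv/= => /andP[x0 _] /andP[_ y1] /andP[xz zy].
  by rewrite (le_trans x0 xz) (le_trans zy y1).
have fxy : {in `[x, y] &, {homo f : a b / a <= b}}.
  by move=> a b axy bxy; apply: f_nondecreasing; exact: sub.
apply: ge_ereal_sup => _ [_ [l xyl <-] <-]; rewrite lee_fin.
rewrite -(nondecreasing_variation fxy xyl) /variation !big_nat.
apply: ler_sum => k /andP[_ kl].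
(* Taking the identity as function shows that consecutive partition points are ordered. *)
have F := nondecreasing_fun_itv_partition (f := fun z => z)
  (fun _ _ _ _ h => h) xyl.
have inl i : (i <= size l)%N -> nth y (x :: l) i \in `[0, 1].
  move=> il; apply: sub; rewrite in_itv/=.
  by rewrite (itv_partition_nth_ge _ xyl) ?(itv_partition_nth_le _ xyl).
have nd := F k kl.
rewrite /= in nd *.
apply: le_trans (ler_norm _).
by apply: limit_variation => //;
  [exact: (inl k (ltnW kl))|exact: (inl k.+1 kl)].
Qed.

(** Passing from the approximation to g costs 2 * 2^-(s+m) at each end of an interval, hence 4 *
    2^-s over all 2^m intervals. *)
Lemma total_variation_limit_ge s :
  (((\sum_(0 <= j < 2 ^ m s) jump (st s) j)%N%:R / 4 ^+ m s - 4 * 2 ^- s)%:E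
    <= total_variation 0 1 g)%E.
Proof.
have h k : (k <= 2 ^ m s)%N ->
  (((\sum_(0 <= j < k) jump (st s) j)%N%:R / 4 ^+ m s
     - k%:R * (4 * 2 ^- (s + m s)))%:E <= total_variation 0 (pt (m s) k) g)%E.
  elim: k => [|k IH] km.
    by rewrite big_geq// !mul0r subr0 pt0 total_variationxx.
  rewrite (@total_variationD _ _ _ (pt (m s) k)); last 2 first.
  - by rewrite -(pt0 (m s)) ler_pt.
  - by rewrite ler_pt.
  apply: le_trans (leeD (IH (ltnW km)) (total_variation_ge g _)); last first.
    by rewrite ler_pt.
  rewrite -EFinD lee_fin big_nat_recr//= natrD mulrDl.
  rewrite -[k.+1%:R]natr1 mulrDl mul1r.
  have -> : (jump (st s) k)%:R / 4 ^+ m s =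
      `|approx s (pt (m s) k.+1) - approx s (pt (m s) k)|.
    rewrite !approx_pt -mulrBl normrM -natr_dist.
    by rewrite [`|_^-1|]ger0_norm ?invr_ge0 ?(ltW (four_gt0 _)).
  have := limit_pt km; have := limit_pt (ltnW km).
  have := ler_distD (g (pt (m s) k.+1)) (approx s (pt (m s) k.+1))
    (approx s (pt (m s) k)).
  have := ler_distD (g (pt (m s) k)) (g (pt (m s) k.+1))
    (approx s (pt (m s) k)).
  rewrite [`|approx s (pt (m s) k.+1) - g _|]distrC; lra.
have := h _ (leqnn _); rewrite pt1; apply: le_trans; rewrite lee_fin.
by rewrite lerD2l lerN2 natrX mulrCA exprD invfM
  [2 ^- s * _]mulrC mulVKf// gt_eqF.
Qed.

(** A rational q between y and [f 1] has arbitrarily large codes, and a code larger than all of the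
    first N can only be enumerated later. *)
Lemma approximations_exhaust y N : y < f 1 -> exists2 s, (N <= s)%N &
  y <= (\sum_(0 <= j < 2 ^ m s) jump (st s) j)%N%:R / 4 ^+ m s.
Proof.
move=> /rat_in_itvoo[q]; rewrite in_itv/= => /andP[/ltW yq qf].
have [e eq] := rat_of_code_onto q.
pose K := (\sum_(0 <= s < N) e0 s)%N.
(* Adding K to both exponents keeps the rational and makes the code exceed K. *)
pose c := code (logn 2 e + K) (logn 3 e + K) (logn 5 e).
have cq : rat_of_code c = q.
  by rewrite rat_of_codeE -eq /rat_of_code !natrD opprD addrACA subrr addr0.
have [s [h0 h1 h2]] : exists s, [/\ e0 s = c, e1 s = 1%N & e2 s = 2%N].
  by apply/(enum01P f0 enumP); rewrite cq.
(* At stage s, [refines] constrains the successor path. *)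
exists s.+1.
  rewrite leqNgt; apply/negP => sN.
  have : (e0 s <= K)%N.
    by rewrite /K (bigD1_seq s) ?mem_index_iota ?iota_uniq//= ?leq_addr// ltnW.
  apply/negP; rewrite -ltnNge h0.
  apply: leq_trans (ltn_expl K (isT : (1 < 2)%N)) _.
  rewrite /c /code -mulnA; apply: leq_trans (_ : 2 ^ (logn 2 e + K) <= _)%N.
    by rewrite leq_exp2l// leq_addl.
  by rewrite leq_pmulr// muln_gt0 !expn_gt0.
apply: le_trans yq _.
have /and4P[_ _ _] := st_refines s; rewrite h1 h2 /=.
rewrite -(ler_nat R) natrD !natrM !natrX -lerBlDr -mulrBl => h.
rewrite -cq -h0 /rat_of_code rmorphM fmorphV/= rmorphB/= !ratr_nat.
rewrite ler_pdivrMr ?ltr0n// mulrAC ler_pdivlMr//.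
Qed.

(** The upper bounds on [0, x] and [x, 1] add up to [f 1], which the variation on [0, 1] reaches; so
    both are attained. *)
Lemma total_variation_limit x : x \in `[0, 1] ->
  (f x)%:E = total_variation 0 x g.
Proof.
move=> x01; have [i0 i1] : (0 : R) \in `[0, 1] /\ (1 : R) \in `[0, 1].
  by rewrite !in_itv/= !lexx ler01.
have /andP[x0 x1] : 0 <= x <= 1 by move: x01; rewrite in_itv.
have := total_variation_limit_le i0 x01 x0.
have := total_variation_limit_le x01 i1 x1.
have V01 : ((f 1)%:E <= total_variation 0 1 g)%E.
  apply/lee_subgt0Pr => e e_gt0; rewrite -EFinB.
  have [N NP] : exists N, forall M, (N <= M)%N -> 2 ^- M < e / 8 :> R.
    by apply: exprn_half_lt; rewrite divr_gt0.
  have [|s Ns] := @approximations_exhaust (f 1 - e / 2) N.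
    by rewrite ltrBlDr ltrDl divr_gt0.
  move=> hs; apply: le_trans (total_variation_limit_ge s); rewrite lee_fin.
  have := NP s Ns; lra.
have := total_variation_ge0 g x0; have := total_variation_ge0 g x1.
move: V01; rewrite (total_variationD _ x0 x1) f0 subr0.
case: (total_variation 0 x g) => [a| |];
  case: (total_variation x 1 g) => [b| |] //=.
rewrite -EFinD !lee_fin => h1 _ _ h4 h5; congr EFin; lra.
Qed.

End with_limit.
End limit.

(** * Enumerating the increments of f, and computability of the limit *)

Lemma truncn_rat_of_code {R : realType} e m : 0 <= rat_of_code e ->
  Num.truncn (ratr (rat_of_code e) * 2 ^+ m : R) =
  (((logn 2 e - logn 3 e) * 2 ^ m) %/ (logn 5 e).+1)%N.
Proof.
rewrite /rat_of_code; set a := logn 2 e; set b := logn 3 e; set c := logn 5 e.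
have c0 : 0 < c.+1%:R :> R by rewrite ltr0n.
rewrite pmulr_lge0 ?invr_gt0 ?ltr0n// subr_ge0 ler_nat => ba.
rewrite rmorphM fmorphV/= rmorphB/= !ratr_nat -natrB// mulrAC -natrX -natrM.
set t := ((a - b) * 2 ^ m)%N; apply: truncn_def.
by rewrite ler_pdivlMr// ltr_pdivrMr// -!natrM ler_nat ltr_nat leq_divM
  ltn_ceil.
Qed.

Lemma enumeration_of_interval_re {R : realType} (f : R -> R) :
  {in `[0, 1] &, {homo f : x y / x <= y}} -> interval_re f ->
  exists e0 e1 e2, [/\ recursive1 e0, recursive1 e1, recursive1 e2 &
    enumerates f e0 e1 e2].
Proof.
move=> f_nd [f0]; rewrite /uniformly_left_re; set S := [set w | _].
have SE c0 c1 c2 : S [tuple c0; c1; c2] <->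
    [/\ 0 <= rat_of_code c1, rat_of_code c1 < rat_of_code c2,
        rat_of_code c2 <= 1 &
        ratr (rat_of_code c0) <
          f (ratr (rat_of_code c2)) - f (ratr (rat_of_code c1))].
  rewrite /S /= !(tnth_nth 0)/= theadE.
  by split=> [[[? [? ?]] ?]|[? ? ? ?]].
case=> [S0|[F [rF SF]]].
  (* The triple (-1, 0, 1) belongs to the set because [f 1 >= 0], which excludes the empty case. *)
  have : S [tuple code 0 1 0; 1%N; 2%N].
    apply/SE; rewrite !rat_of_codeE ?rat_of_code1 ?rat_of_code2.
    rewrite (rmorph0 (@ratr R)) (rmorph1 (@ratr R)) f0 subr0 lexx ltr01 lexx.
    split=> //; rewrite sub0r divr1 rmorphN1.
    apply: lt_le_trans (_ : 0 <= _); first by rewrite ltrN10.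
    by rewrite -f0 f_nd// ?in_itv/= ?lexx ?ler01.
  by rewrite S0.
pose e i n := F i [tuple n].
have re i : recursive1 (e i).
  move=> k h rh.
  exact: (recursive_subst (rF i) (recursive_map_cons rh (recursive_map_nil k))).
exists (e ord0), (e (lift ord0 ord0)), (e ord_max); split=> // c0 c1 c2.
rewrite -SE SF; split=> [[n [<- <- <-]]|[n _ nE]]; exists n => //.
- apply: eq_from_tnth => i; rewrite tnth_mktuple.
  by case: i => -[|[|[|//]]] i3; rewrite (tnth_nth 0%N)/= /e; congr (F _ _);
    exact: val_inj.
- move/(congr1 (fun t : 3.-tuple nat =>
    [:: tnth t ord0; tnth t (lift ord0 ord0); tnth t ord_max])) : nE.
  by rewrite !tnth_mktuple !(tnth_nth 0%N)/= => -[].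
Qed.

Theorem theorem3p5 (R : realType) (f : R -> R)
  (f_continuous : {within `[0, 1], continuous f})
  (f_nondecreasing : {in `[0, 1] &, {homo f : x y / x <= y}})
  (f_interval_re : interval_re f) :
  exists g : R -> R,
    computable_function g /\
    forall x : R, x \in `[0, 1] -> (f x)%:E = total_variation 0 x g.
Proof.
have f0 : f 0 = 0 by case: f_interval_re.
have f_uniform := uniform_continuity_segment f_continuous.
have [e0 [e1 [e2 [re0 re1 re2 enumP]]]] :=
  enumeration_of_interval_re f_nondecreasing f_interval_re.
have f_mesh (e : R) : 0 < e -> exists N, forall M, (N <= M)%N ->
    forall i, (i < 2 ^ M)%N -> f (pt M i.+1) - f (pt M i) <= e.
  move=> /f_uniform[del /exprn_half_lt[N NP] delP].
  exists N => M /NP Mdel i iM; apply: le_trans (ler_norm _) _; apply/ltW.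
  apply: delP; rewrite ?pt_itv// 1?ltnW//.
  rewrite /pt -mulrBl -[i.+1%:R]natr1 [_ + 1]addrC addrK mul1r.
  by rewrite ger0_norm// invr_ge0 exprn_ge0.
pose C := (Num.truncn (f 1)).+1.
have f_le_C : f 1 <= C%:R by exact/ltW/truncnS_gt.
(* The initial path is constant on the grid consisting of 0 and 1. *)
have [r0 [lev0 _ val0]] := exists_state 0 0 (fun=> C) 2.
have valid0 : valid C e0 e1 e2 0 r0.
  rewrite /valid lev0 /jump !val0// muln1 eqxx /=.
  by rewrite /jump !val0// /dist subnn.
have [|st rst [st0 st_step]] :=
    recursive_dependent_choice r0 (recursive_step_relation C re0 re1 re2).
  move=> s r; have [vr|nvr] := boolP (valid C e0 e1 e2 s r); last first.
    by exists 0%N; rewrite /step (negbTE nvr).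
  have [n nP] := exists_refinement f0 f_nondecreasing f_mesh f_le_C enumP vr.
  by exists n; rewrite /step nP implybT.
have st_valid s : valid C e0 e1 e2 s (st s).
  elim: s => [|s vs]; first by rewrite st0.
  by have := st_step s; rewrite /step vs /= => /andP[].
have st_refines s : refines e0 e1 e2 s (st s) (st s.+1).
  by have := st_step s; rewrite /step st_valid /= => /andP[].
have [g gP] := exists_limit st_refines (R := R).
exists g; split; last first.
  move=> x; exact: (total_variation_limit f0 f_nondecreasing f_uniform enumP
    st_valid st_refines gP).
split.
  (* Evaluates approximation n + 4 in the grid cell found from the code; its error 6 * 2^-(n+4) is
     below 2^-n. *)
  exists (fun v : 2.-tuple nat =>
    let r := st (thead v + 4) in let e := thead [tuple of behead v] in
    code (val_at r (((logn 2 e - logn 3 e) * 2 ^ lev r) %/ (logn 5 e).+1)) 0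
      (4 ^ lev r).-1)%N.
    rewrite /val_at /bnd /lev /code; cbv zeta.
    by recursive_tac.
  move=> n v [q0 q1]; rewrite ratr_code4 !theadE behead_consE.
  have qE : thead (rats_of_codes v) = rat_of_code (thead v).
    by rewrite [LHS](tnth_map).
  rewrite qE in q0 q1 *.
  (* Since the rational is nonnegative, the truncated difference of exponents is exact. *)
  rewrite -(@truncn_rat_of_code R)//.
  have q01 : (ratr (rat_of_code (thead v)) : R) \in `[0, 1].
    by rewrite in_itv/= ler0q q0 -(rmorph1 (@ratr R)) ler_rat.
  apply: le_trans (gP _ q01 (n + 4)%N) _.
  rewrite exprD invfM mulrCA ger_pMr ?invr_gt0 ?exprn_gt0//.
  by rewrite -natrX ler_pdivrMr ?ltr0n// mul1r ler_nat.
exists (fun v => lev (st (thead v + 4)))%N.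
  by rewrite /lev; recursive_tac.
move=> n x y x01 y01; rewrite theadE.
exact: (limit_modulus enumP st_valid gP).
Qed.
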